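(* For any integer $D\in[1,n]$, there exists a $D$-preserving distance labeling scheme for the family $\mathcal G_n$ of unweighted graphs on $n$ nodes with maximum label size \[ O\!\left(\frac{n}{D}\max\{\log^2 D,1\}\right), \] where the constant in the $O$ is independent of $n$ and $D$.
   Context: Let $D$ be a positive integer and $\mathcal G$ a family of graphs. A $D$-preserving distance labeling scheme for $\mathcal G$ consists of, for each $G\in\mathcal G$, a map $e_G:V(G)\to\{0,1\}^*$ (the labels), and a single decoder $d:\{0,1\}^*\times\{0,1\}^*\to\mathbb{Z}$ (not depending on $G$) such that for all $G\in\mathcal G$: (1) $d(e_G(u),e_G(v))\ge dist_G(u,v)$ for all $u,v\in V(G)$, and (2) $d(e_G(u),e_G(v))=dist_G(u,v)$ for all $u,v\in V(G)$ with $dist_G(u,v)\ge D$. Here $dist_G$ is the shortest-path distance (number of edges). The maximum label size is the maximum of $|e_G(u)|$ over all $G\in\mathcal G$, $u\in V(G)$. Graphs are unweighted; the paper states the result for both undirected and directed graphs (for directed graphs $dist_G$ is directed distance). $\log$ is the natural logarithm. *)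

(* Defs.v *)
From Stdlib Require Import Reals ZArith.
From mathcomp Require Import all_boot.

Set Implicit Arguments.
Unset Strict Implicit.
Unset Printing Implicit Defensive.

Definition walk (n : nat) (e : rel 'I_n) (k : nat) (u v : 'I_n) : Prop :=
  exists p : seq 'I_n, size p = k /\ path e u p /\ last u p = v.

Definition is_dist (n : nat) (e : rel 'I_n) (u v : 'I_n) (k : nat) : Prop :=
  walk e k u v /\ forall j, (j < k)%N -> ~ walk e j u v.

Definition undirected (n : nat) (e : rel 'I_n) : Prop :=
  symmetric e /\ irreflexive e.

Definition preserving_scheme (n : nat) (family : rel 'I_n -> Prop) (D : nat)
    (dec : seq bool -> seq bool -> Z) (L : R) : Prop :=
  forall e : rel 'I_n, family e ->
  exists lab : 'I_n -> seq bool,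
    (forall u, Rle (INR (size (lab u))) L) /\
    (forall u v k, is_dist e u v k ->
       Z.le (Z.of_nat k) (dec (lab u) (lab v)) /\
       ((D <= k)%N -> dec (lab u) (lab v) = Z.of_nat k)).

(* Main.v *)
(** Treat the distances in each dyadic band [d, 2d) with d = 2^i D separately.
    A pair at such a distance has at least d vertices on its shortest paths, so a
    greedily chosen set of O((n/d) log d) hubs misses at most n^2/d^2 such pairs;
    at most n/d vertices u are in more than n/d missed pairs (u, v), and making
    these u hubs as well leaves at most n/d missed partners per vertex.  A label
    stores its vertex, its distances to and from the hubs as far as these are
    below 2d, which costs O(log d) bits per hub also in directed graphs, and the
    distances to the missed partners.  A band thus costs O((n/d) log^2 d) bits,
    and the sum over the bands is dominated by the first one.  The decoder takes
    the least of all the estimates. *)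

Require Import Defs.
From Stdlib Require Import Reals ZArith.
From mathcomp Require Import all_boot.
From Stdlib Require Import Lra.
From mathcomp Require Import zify.

Set Implicit Arguments.
Unset Strict Implicit.
Unset Printing Implicit Defensive.

(** * Walks, distances and shortest-path vertices *)

Section Distance.

Variables (n : nat) (e : rel 'I_n).

Definition walkb k (u v : 'I_n) :=
  [exists p : k.-tuple 'I_n, path e u p && (last u p == v)].

Lemma walkP k u v : reflect (walk e k u v) (walkb k u v).
Proof.
apply: (iffP existsP) => [[p /andP[pp /eqP lp]]|[p [sp [pp lp]]]].
  by exists p; rewrite size_tuple.
have sp' : size p == k by apply/eqP.
by exists (Tuple sp') => /=; rewrite pp lp eqxx.
Qed.

Definition is_distb u v k :=
  walkb k u v && [forall j : 'I_k, ~~ walkb j u v].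

Lemma is_distP u v k : reflect (is_dist e u v k) (is_distb u v k).
Proof.
apply: (iffP andP) => [[/walkP w /forallP nw]|[w nw]]; split => //.
- by move=> j ltjk /walkP wj; move: (nw (Ordinal ltjk)); rewrite wj.
- exact/walkP.
- by apply/forallP => j; apply/walkP/nw.
Qed.

Lemma is_dist_leq u v k j : is_dist e u v k -> walk e j u v -> k <= j.
Proof. by move=> [_ nw] wj; rewrite leqNgt; apply/negP => /nw. Qed.

Lemma is_dist_inj u v k j : is_dist e u v k -> is_dist e u v j -> k = j.
Proof.
move=> dk dj; apply/eqP; rewrite eqn_leq (is_dist_leq dk (proj1 dj)).
exact: is_dist_leq dj (proj1 dk).
Qed.

Lemma walk_cat a b u w v : walk e a u w -> walk e b w v -> walk e (a + b) u v.
Proof.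
move=> [p [<- [pp lp]]] [r [<- [pr lr]]]; exists (p ++ r).
by rewrite size_cat cat_path last_cat lp pp pr lr.
Qed.

Lemma is_dist_refl u : is_dist e u u 0.
Proof. by split=> [|j //]; exists [::]. Qed.

Lemma is_dist_ltn u v k : is_dist e u v k -> k < n.
Proof.
move=> dk; have [p [_ [pp lp]]] := proj1 dk.
case/shortenP: pp lp => p' pp' up' _ lp'.
have /(is_dist_leq dk) le_k : walk e (size p') u v by exists p'.
apply: leq_ltn_trans le_k _; rewrite -[X in _ <= X]card_ord.
by have := max_card (mem (u :: p')); rewrite (card_uniqP up').
Qed.

(** The vertices on shortest paths, endpoints included. Bounding [a] and [b] by [n] loses nothing,
    by [is_dist_ltn]. *)
Definition midpoints u v : {set 'I_n} :=
  [set w | [exists a : 'I_n, exists b : 'I_n,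
     [&& is_distb u w a, is_distb w v b & is_distb u v (a + b)]]].

Lemma midpointsP u v w :
  reflect (exists a b, [/\ is_dist e u w a, is_dist e w v b
                         & is_dist e u v (a + b)])
          (w \in midpoints u v).
Proof.
rewrite inE; apply: (iffP existsP).
  move=> [a /existsP[b /and3P[/is_distP da /is_distP db /is_distP dab]]].
  by exists a, b.
move=> [a [b [da db dab]]]; exists (Ordinal (is_dist_ltn da)).
apply/existsP; exists (Ordinal (is_dist_ltn db)) => /=.
by apply/and3P; split; apply/is_distP.
Qed.

(** The first [k] vertices of a shortest path have the distinct distances [0, ..., k - 1] from
    [u]. *)
Lemma card_midpoints u v k : is_dist e u v k -> k <= #|midpoints u v|.
Proof.
move=> dk; have [p [sp [pp lp]]] := proj1 dk.
pose w i := last u (take i p).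
have wdist i : i <= k -> is_dist e u (w i) i /\ is_dist e (w i) v (k - i).
  move=> le_ik; have w1 : walk e i u (w i).
    exists (take i p); split; first by rewrite size_takel ?sp.
    by split=> //; move: pp; rewrite -{1}(cat_take_drop i p) cat_path => /andP[].
  have w2 : walk e (k - i) (w i) v.
    exists (drop i p); split; first by rewrite size_drop sp.
    move: pp lp; rewrite -{1 2}(cat_take_drop i p) cat_path last_cat.
    by move=> /andP[].
  split; split=> // j ltj wj.
    by have := is_dist_leq dk (walk_cat wj w2); lia.
  by have := is_dist_leq dk (walk_cat w1 wj); lia.
have inj : injective (fun i : 'I_k => w i).
  move=> i j eqw; apply/val_inj => /=.
  have [di _] := wdist i (ltnW (ltn_ord i)).
  have [dj _] := wdist j (ltnW (ltn_ord j)).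
  by move: dj; rewrite -eqw; apply: is_dist_inj di.
rewrite -[k in k <= _]card_ord -(card_imset _ inj) subset_leq_card //.
apply/subsetP => x /imsetP[i _ ->]; apply/midpointsP.
have [di dvi] := wdist i (ltnW (ltn_ord i)).
by exists i, (k - i); rewrite subnKC // ltnW.
Qed.

End Distance.

(** * Greedy hitting sets *)

Section Hitting.

Variables (V P : finType) (F : P -> {set V}) (A : {set P}) (d : nat).
Hypotheses (F_big : forall p, p \in A -> d <= #|F p|) (d_le : d <= #|V|).

Definition unhit (W : seq V) := [set p in A | ~~ has (mem (F p)) W].

(** Double counting: an average [v] lies in at least [#|U| * d / #|V|] of the sets. *)
Lemma exists_popular (U : {set P}) : 0 < #|V| -> U \subset A ->
  exists v, #|U| * d <= #|V| * #|[set p in U | v \in F p]|.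
Proof.
move=> V_gt0 sUA.
have double : \sum_v #|[set p in U | v \in F p]| = \sum_(p in U) #|F p|.
  under eq_bigr do rewrite -sum1dep_card big_mkcondr.
  rewrite exchange_big /=; apply: eq_bigr => p _.
  by rewrite -big_mkcond sum1_card.
have [/existsP //|/existsPn none] := boolP
  [exists v, #|U| * d <= #|V| * #|[set p in U | v \in F p]|].
have : \sum_(v : V) #|V| * #|[set p in U | v \in F p]| <
       \sum_(v : V) #|U| * d.
  have /card_gt0P[v0 _] := V_gt0.
  rewrite [X in X < _](bigD1 v0) //= [X in _ < X](bigD1 v0) //=.
  rewrite -addSn leq_add ?ltnNge ?none // leq_sum // => v _.
  by rewrite ltnW // ltnNge none.
rewrite -big_distrr /= double sum_nat_const ltn_mul2l V_gt0 /= ltnNge.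
rewrite -sum_nat_const leq_sum // => p pU.
by rewrite F_big // (subsetP sUA).
Qed.

(** Adding a popular element leaves at most a fraction [1 - d / #|V|] of the unhit sets. *)
Lemma greedy_hitting t : 0 < #|V| ->
  exists W, size W = t /\ #|V| ^ t * #|unhit W| <= (#|V| - d) ^ t * #|A|.
Proof.
move=> V_gt0; elim: t => [|t [W [sW IH]]].
  exists [::]; rewrite !expn0 !mul1n; split=> //.
  by apply/subset_leq_card/subsetP => p; rewrite inE => /andP[].
have [|v hv] := @exists_popular (unhit W) V_gt0.
  by apply/subsetP => p; rewrite inE => /andP[].
exists (v :: W); split; first by rewrite /= sW.
have split_unhit :
    #|unhit W| = #|[set p in unhit W | v \in F p]| + #|unhit (v :: W)|.
  rewrite -(cardsID [set p | v \in F p]); congr (_ + _); apply: eq_card => p.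
    by rewrite !inE.
  by rewrite !inE /= negb_or andbCA.
have step : #|V| * #|unhit (v :: W)| <= (#|V| - d) * #|unhit W|.
  rewrite mulnBl leq_subRL; last by rewrite leq_mul2r d_le orbT.
  by rewrite {2}split_unhit mulnDr leq_add2r mulnC.
rewrite expnSr -mulnA; apply: leq_trans (leq_mul (leqnn _) step) _.
by rewrite mulnCA [X in _ <= X * _]expnS -mulnA leq_mul2l IH orbT.
Qed.

End Hitting.

(** * Power inequalities *)

(* Bernoulli's inequality [(1 - d/n)^q <= 1 / (1 + q d / n)], denominators cleared. *)
Lemma bernoulli_sub n d q : d <= n -> (n - d) ^ q * (n + q * d) <= n ^ q.+1.
Proof.
move=> le_dn; elim: q => [|q IH]; first by rewrite expn0 mul0n addn0 mul1n expn1.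
rewrite [n ^ _]expnS expnSr -mulnA.
apply: leq_trans (leq_mul (leqnn n) IH).
rewrite [X in _ <= X]mulnCA leq_mul2l; apply/orP; right; nia.
Qed.

(** Bernoulli gives [(1 - d/n)^q <= 1/2] once [q >= n/d]; take [r] such blocks. *)
Lemma expn_sub_half n d q r : 0 < n -> d <= n -> n <= q * d ->
  2 ^ r * (n - d) ^ (q * r) <= n ^ (q * r).
Proof.
move=> n_gt0 le_dn le_nqd.
have half : 2 * (n - d) ^ q <= n ^ q.
  rewrite -(leq_pmul2r n_gt0) -expnSr -mulnA mulnCA.
  apply: leq_trans (bernoulli_sub q le_dn).
  by rewrite leq_mul2l mul2n -addnn leq_add2l le_nqd orbT.
elim: r => [|r IH]; first by rewrite muln0.
by rewrite mulnS !expnD expnS mulnACA leq_mul.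
Qed.

(* Bernoulli's inequality [(1 + 1/x)^j <= 1 / (1 - j/x)], denominators cleared. *)
Lemma bernoulli_add x j : x.+1 ^ j * (x - j) <= x ^ j.+1.
Proof.
elim: j => [|j IH]; first by rewrite subn0 mul1n expn1.
rewrite [x ^ _]expnS expnSr -mulnA.
apply: leq_trans (leq_mul (leqnn x) IH).
rewrite [X in _ <= X]mulnCA leq_mul2l; apply/orP; right; nia.
Qed.

Lemma expnS_double d j : 0 < d -> j <= d -> (2 * d).+1 ^ j <= 2 * (2 * d) ^ j.
Proof.
move=> d_gt0 le_jd; rewrite -(leq_pmul2r d_gt0).
have := bernoulli_add (2 * d) j; rewrite expnS => le1.
have : (2 * d).+1 ^ j * d <= (2 * d).+1 ^ j * (2 * d - j).
  by rewrite leq_mul2l; apply/orP; right; lia.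
by move=> /leq_trans/(_ le1); rewrite -mulnA [d * _]mulnC mulnA.
Qed.

(** Cut the exponent into [n %/ d] blocks of length [d] and a shorter rest. *)
Lemma expnS_double_divn d n : 0 < d ->
  (2 * d).+1 ^ n <= 2 ^ (n %/ d).+1 * (2 * d) ^ n.
Proof.
move=> d_gt0; rewrite {1 3}(divn_eq n d); elim: (n %/ d) => [|a IH].
  by rewrite mul0n add0n expn1 expnS_double // ltnW // ltn_mod.
rewrite mulSn -addnA; move: (a * d + n %% d) IH => b IH.
rewrite !(expnD _ d) [2 ^ a.+2]expnS mulnACA.
by rewrite leq_mul // expnS_double.
Qed.

(** * Counting tables with few entries *)

Section SparseFunctions.

Variables (n d : nat).

(** Models the table of distances to missed partners; [None] marks all other vertices. *)
Definition sparse (f : {ffun 'I_n -> option 'I_(2 * d)}) :=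
  #|[set x | f x]| <= n %/ d.

Definition sparse_fun := {f | sparse f}.

(* Give a function the weight [w ^ #|[set x | f x == None]|] with [w = (2d)^2]:
   the weights sum to [(w + 2d)^n], and a sparse function has weight at least
   [w ^ (n - n %/ d)]. *)
Lemma card_sparse_fun :
  0 < d -> #|{: sparse_fun}| <= (2 * d) ^ (2 * (n %/ d)) * 2 ^ (n %/ d).+1.
Proof.
move=> d_gt0; pose w := (2 * d) ^ 2; pose K := n %/ d.
have total : \sum_(f : {ffun 'I_n -> option 'I_(2 * d)})
    \prod_x (if f x then 1 else w) = (w + 2 * d) ^ n.
  rewrite -(bigA_distr_bigA (fun (_ : 'I_n) y => if isSome y then 1 else w)).
  rewrite prod_nat_const card_ord (bigD1 None) //=; congr ((_ + _) ^ _).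
  rewrite (eq_bigr (fun=> 1)) => [|[]//].
  rewrite sum1_card (cardC1 None) card_option card_ord //.
have le_Kn : K <= n by exact: leq_div.
have weight (f : {ffun 'I_n -> option 'I_(2 * d)}) : sparse f ->
    w ^ (n - K) <= \prod_x (if f x then 1 else w).
  rewrite /sparse => sf; rewrite (bigID (fun x => f x : bool)) /=.
  rewrite big1 => [|x ->//]; rewrite mul1n.
  rewrite (eq_bigr (fun=> w)) => [|x /negbTE->//].
  rewrite prod_nat_const leq_pexp2l ?expn_gt0 ?muln_gt0 ?d_gt0 //.
  rewrite -[n in n - _]card_ord -(cardC [set x | f x]) leq_subLR.
  rewrite leq_add //.
  by apply/subset_leq_card/subsetP => x; rewrite !inE.
have sum_le : #|{: sparse_fun}| * w ^ (n - K) <= (w + 2 * d) ^ n.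
  rewrite -total card_sig -sum_nat_const [X in _ <= X](bigID sparse) /=.
  by apply: leq_trans (leq_addr _ _); apply: leq_sum => f; apply: weight.
(* Since [w + 2d = 2d(2d + 1)], only [(1 + 1/(2d))^n] is left to bound. *)
have w2d : (w + 2 * d) ^ n = (2 * d) ^ n * (2 * d).+1 ^ n.
  by rewrite -expnMn mulnS addnC.
have wn : w ^ (n - K) * (2 * d) ^ (2 * K) = (2 * d) ^ n * (2 * d) ^ n.
  by rewrite expnM -[_ ^ 2]/w -expnD subnK // -expnMn.
have w_gt0 : 0 < w ^ (n - K) by rewrite !expn_gt0 muln_gt0 d_gt0.
rewrite -(leq_pmul2r w_gt0); apply: leq_trans sum_le _.
rewrite [X in _ <= X]mulnC mulnA wn w2d -mulnA leq_mul2l; apply/orP; right.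
by rewrite [X in _ <= X]mulnC expnS_double_divn.
Qed.

End SparseFunctions.

(** * Choice of the hubs *)

Section Hubs.

Variables (n d : nat) (e : rel 'I_n).
Hypotheses (d_gt0 : 0 < d) (d_le : d <= n).
Let l := trunc_log 2 d.
Let q := (n %/ d).+1.

Definition in_band u v :=
  [exists k : 'I_n, (d <= k < 2 * d) && is_distb e u v k].

Definition missed (W : seq 'I_n) u : {set 'I_n} :=
  [set v | in_band u v && ~~ has (mem (midpoints e u v)) W].

(** Each block of [q] greedy choices at least halves the missed pairs, and [2 * l.+1] halvings gain
    a factor [d ^ 2]. *)
Lemma exists_average_hubs :
  exists W : seq 'I_n, size W = q * (2 * l.+1) /\
    d ^ 2 * \sum_u #|missed W u| <= n ^ 2.
Proof.
have n_gt0 : 0 < n by apply: leq_trans d_le.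
pose A := [set p : 'I_n * 'I_n | in_band p.1 p.2].
pose F (p : 'I_n * 'I_n) := midpoints e p.1 p.2.
have F_big p : p \in A -> d <= #|F p|.
  rewrite inE => /existsP[k /andP[/andP[le_dk _] /is_distP dk]].
  exact: leq_trans le_dk (card_midpoints dk).
have [||W [sW leW]] := greedy_hitting F_big _ (q * (2 * l.+1)); rewrite ?card_ord //.
rewrite card_ord in leW.
exists W; split=> //.
have -> : \sum_u #|missed W u| = #|unhit F A W|.
  rewrite -sum1_card; under eq_bigr do rewrite -sum1_card.
  rewrite pair_big_dep /=; apply: eq_bigl => -[u v].
  by rewrite !inE.
have le_A : #|A| <= n ^ 2.
  by rewrite (leq_trans (max_card _)) // card_prod card_ord.
have n_qd : n <= q * d by rewrite ltnW // ltn_ceil.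
have := expn_sub_half (2 * l.+1) n_gt0 d_le n_qd.
set t := q * _ in leW *; move=> half.
have nt_gt0 : 0 < n ^ t by rewrite expn_gt0 n_gt0.
have d_lt : d ^ 2 <= 2 ^ (2 * l.+1).
  by rewrite mulnC expnM leq_exp2r // ltnW // trunc_log_ltn.
rewrite -(leq_pmul2l nt_gt0) mulnCA.
apply: leq_trans (leq_mul d_lt leW) _.
by rewrite mulnA leq_mul.
Qed.

(** By Markov's inequality at most [n %/ d] vertices miss too many partners; they become hubs too.
    The fixed length lets all graphs share one label type. *)
Lemma exists_hubs :
  exists W : (q * (2 * l + 3)).-tuple 'I_n, forall u, #|missed W u| <= n %/ d.
Proof.
have n_gt0 : 0 < n by apply: leq_trans d_le.
have [W [sW leW]] := exists_average_hubs.
pose H := [set u | n < d * #|missed W u|].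
have le_H : #|H| <= n %/ d.
  rewrite leq_divRL // -(leq_pmul2r n_gt0).
  have le1 : #|H| * n <= d * \sum_u #|missed W u|.
    rewrite big_distrr /= -sum_nat_const [X in _ <= X](bigID (mem H)) /=.
    apply: leq_trans (leq_addr _ _); apply: leq_sum => u.
    by rewrite inE => /ltnW.
  rewrite mulnAC mulnC; apply: leq_trans (leq_mul (leqnn d) le1) _.
  by rewrite mulnA.
(* As [#|H| < q], padding with copies of one vertex gives exactly [q] extra entries. *)
pose W' := W ++ enum H ++ nseq (q - #|H|) (Ordinal n_gt0).
have sW' : size W' == q * (2 * l + 3).
  rewrite !size_cat sW size_nseq -cardE subnKC; last by rewrite /q ltnW.
  by apply/eqP; lia.
exists (Tuple sW') => u /=.
have [uH|] := boolP (u \in H).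
  (* A hub [u] is itself a midpoint of every pair [(u, v)] in the band. *)
  rewrite (_ : missed _ u = set0) ?cards0 //; apply/setP=> v; rewrite !inE.
  apply/negP => /andP[/existsP[k /andP[_ /is_distP dk]]].
  rewrite !has_cat; case/norP=> _ /norP[/hasPn/(_ u)]; rewrite mem_enum => /(_ uH).
  move=> /negP[]; apply/midpointsP; exists 0, k.
  by split=> //; apply: is_dist_refl.
rewrite inE -leqNgt mulnC -leq_divRL //; apply: leq_trans.
apply/subset_leq_card/subsetP => v; rewrite !inE => /andP[-> /=].
by rewrite has_cat negb_or => /andP[].
Qed.

End Hubs.

(** * Labelings with a finite label type *)

(* A labeling is a map into a fixed type with at most [2 ^ m] elements; such a
   type is encoded by words of length [m] only at the very end. *)
Definition labeling n (R : pred nat) m := exists (T : finType) (dec : T -> T -> nat),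
  #|T| <= 2 ^ m /\
  forall e : rel 'I_n, exists lab : 'I_n -> T, forall u v k, is_dist e u v k ->
    k <= dec (lab u) (lab v) /\ (R k -> dec (lab u) (lab v) = k).

(** Only walk lengths are accepted, so the least accepted value is no underestimate; [find] defaults
    to [n], above every distance. *)
Lemma labeling_of_estimates n (R : pred nat) m (T : finType) (est : T -> T -> pred nat) :
    #|T| <= 2 ^ m ->
    (forall e : rel 'I_n, exists lab : 'I_n -> T, forall u v k,
      (est (lab u) (lab v) k -> walk e k u v) /\
      (R k -> is_dist e u v k -> est (lab u) (lab v) k)) ->
  labeling n R m.
Proof.
move=> leT estP; exists T, (fun x y => find (est x y) (iota 0 n)); split=> // e.
have [lab labP] := estP e; exists lab => u v k dk.
set E := est _ _; set c := find E _.
have k_lt := is_dist_ltn dk.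
have le_kc : k <= c.
  have [lt_cn|] := ltnP c n; last by apply: leq_trans; apply: ltnW.
  have : E (nth 0 (iota 0 n) c) by rewrite nth_find // has_find size_iota.
  by rewrite nth_iota // add0n => /(proj1 (labP u v c)); apply: is_dist_leq.
split=> // Rk; apply/eqP; rewrite eqn_leq le_kc andbT leqNgt.
apply/negP=> /(before_find 0); rewrite nth_iota // add0n.
by rewrite /E (proj2 (labP u v k) Rk dk).
Qed.

(** Both decoders never underestimate, so their minimum is exact where either is. *)
Lemma labeling_union n (R R1 R2 : pred nat) m1 m2 :
  (forall k, R k -> R1 k || R2 k) ->
  labeling n R1 m1 -> labeling n R2 m2 -> labeling n R (m1 + m2).
Proof.
move=> RU [T1 [dec1 [le1 P1]]] [T2 [dec2 [le2 P2]]].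
exists (T1 * T2)%type, (fun x y => minn (dec1 x.1 y.1) (dec2 x.2 y.2)).
split; first by rewrite card_prod expnD leq_mul.
move=> e; have [lab1 L1] := P1 e; have [lab2 L2] := P2 e.
exists (fun u => (lab1 u, lab2 u)) => u v k dk /=.
have [ge1 eq1] := L1 u v k dk; have [ge2 eq2] := L2 u v k dk.
split; first by rewrite leq_min ge1.
by move=> /RU/orP[/eq1->|/eq2->]; [apply/minn_idPl | apply/minn_idPr].
Qed.

(** * One dyadic band *)

(** A label holds the vertex, a row of distances to the hubs, a row from the hubs, and the sparse
    table. In the band, either [v] is in the table or a hub lies on a shortest path. *)
Lemma labeling_band n d : 0 < d -> d <= n ->
  exists m, m * d <= 38 * n * (trunc_log 2 d).+1 ^ 2 /\
    labeling n (fun k => d <= k < 2 * d) m.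
Proof.
move=> d_gt0 d_le; set l := trunc_log 2 d.
pose q := (n %/ d).+1; pose M := q * (2 * l + 3).
have d_lt : d < 2 ^ l.+1 by apply: trunc_log_ltn.
exists (q + l.+1 + (l.+2 * M + (l.+2 * M + (l.+2 * (2 * (n %/ d)) + q)))); split.
  have qd : q * d <= 2 * n by rewrite mul2n /q mulSn -addnn leq_add // leq_trunc_div.
  (* With [L = l + 1], the two rows cost at most [12 q L^2], the sparse entries [4 q L^2], and the
     rest [3 q L^2]. *)
  apply: (@leq_trans (q * (19 * l.+1 ^ 2) * d)); last by nia.
  rewrite leq_mul2r; apply/orP; right.
  rewrite /M {M}; have le_Kq : n %/ d <= q by exact: leqnSn.
  have : 0 < q by []. clearbody q; nia.
pose row := {ffun 'I_M -> option 'I_(2 * d)}.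
pose est (x y : 'I_n * (row * (row * sparse_fun n d))) : pred nat := fun c =>
  let: (_, (xo, (_, xe))) := x in let: (y0, (_, (yi, _))) := y in
  (if val xe y0 is Some k then k == c :> nat else false) ||
  [exists j, if (xo j, yi j) is (Some a, Some b) then a + b == c else false].
apply: (@labeling_of_estimates _ _ _ _ est).
  have d2_lt : 2 * d < 2 ^ l.+2 by rewrite expnS ltn_mul2l.
  have row_le : #|{: row}| <= 2 ^ (l.+2 * M).
    by rewrite card_ffun card_option !card_ord expnM leq_exp2r // muln_gt0 addn3.
  (* Here [n < q * d], [q < 2^q] and [d < 2^(l+1)], so naming a vertex costs no [log n] term. *)
  have id_le : n <= 2 ^ (q + l.+1).
    apply: ltnW; apply: leq_trans (ltn_ceil n d_gt0) _.
    by rewrite expnD leq_mul // ltnW // ltn_expl.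
  have sparse_le : #|{: sparse_fun n d}| <= 2 ^ (l.+2 * (2 * (n %/ d)) + q).
    apply: leq_trans (card_sparse_fun _ d_gt0) _.
    rewrite expnD leq_mul2r [2 ^ (_ * _)]expnM; apply/orP; right.
    by case: (n %/ d) => [//|K]; rewrite leq_exp2r ?muln_gt0 // ltnW.
  rewrite !card_prod card_ord expnD leq_mul // expnD leq_mul //.
  by rewrite expnD leq_mul.
move=> e; have [W leW] := exists_hubs e d_gt0 d_le.
pose sdist u v : option 'I_(2 * d) := [pick k : 'I_(2 * d) | is_distb e u v k].
have sdistP u v k : sdist u v = Some k -> is_dist e u v k.
  by rewrite /sdist; case: pickP => // k' /is_distP dk [<-].
have sdistE u v k : is_dist e u v k -> k < 2 * d ->
    exists2 k' : 'I_(2 * d), sdist u v = Some k' & k' = k :> nat.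
  move=> dk lt_k; rewrite /sdist; case: pickP => [k' /is_distP dk'|/(_ (Ordinal lt_k))].
    by exists k'; last exact: is_dist_inj dk' dk.
  by move=> /is_distP.
pose exc u := [ffun v => if v \in missed d e W u then sdist u v else None].
have excP u : sparse (exc u).
  apply: leq_trans (leW u); apply/subset_leq_card/subsetP => v.
  by rewrite inE ffunE; case: ifP.
exists (fun u => (u, ([ffun j => sdist u (tnth W j)] : row,
  ([ffun j => sdist (tnth W j) u] : row, exist (@sparse n d) _ (excP u))))).
move=> u v k /=; split.
  case/orP.
    rewrite ffunE; case: ifP => // _; case Es: (sdist u v) => [k'|//] /eqP <-.
    exact: proj1 (sdistP _ _ _ Es).
  move=> /existsP[j]; rewrite !ffunE.
  case Eo: (sdist u _) => [a|//]; case Ei: (sdist _ v) => [b|//] /eqP <-.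
  exact: walk_cat (proj1 (sdistP _ _ _ Eo)) (proj1 (sdistP _ _ _ Ei)).
move=> band_k dk; have /andP[_ k_lt] := band_k.
rewrite ffunE; case: ifP => [_|].
  by have [k' -> ->] := sdistE _ _ _ dk k_lt; rewrite eqxx.
rewrite inE (_ : in_band d e u v) /=; last first.
  apply/existsP; exists (Ordinal (is_dist_ltn dk)) => /=.
  by rewrite band_k; apply/is_distP.
move=> /negbFE/hasP[w /tnthP[j ->]] /midpointsP[a [b [da db dab]]].
apply/existsP; exists j; rewrite !ffunE.
have eq_k := is_dist_inj dk dab.
have [|a' -> ->] := sdistE _ _ _ da; first by lia.
have [|b' -> ->] := sdistE _ _ _ db; first by lia.
by rewrite eq_k.
Qed.

(** * Summation over the bands *)

Lemma labeling_from n d : 0 < d ->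
  exists m, m * d <= 152 * n * (trunc_log 2 d + 5) ^ 2 /\ labeling n (leq d) m.
Proof.
have [N] := ubnP (n - d); elim: N d => // N IH d lt_nd d_gt0.
have [le_nd|lt_dn] := leqP n d.
  (* All distances are below [n <= d], so a constant decoder on empty labels suffices. *)
  exists 0; split=> //; exists unit, (fun _ _ => n); split; first by rewrite card_unit.
  move=> e; exists (fun=> tt) => u v k /is_dist_ltn lt_k; split; first exact: ltnW.
  by move=> le_dk; move: (leq_ltn_trans le_dk (leq_trans lt_k le_nd)); rewrite ltnn.
have [m1 [le1 lab1]] := labeling_band d_gt0 (ltnW lt_dn).
have [||m2 [le2 lab2]] := IH (2 * d); [by lia | by lia |].
exists (m1 + m2); split.
  move: le1 le2; rewrite mul2n trunc_log2_double // -mul2n.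
  move: (trunc_log 2 d) => l le1 le2.
  (* After doubling, [76 (l+1)^2 + 152 (l+6)^2 <= 304 (l+5)^2] remains; the shift 5 makes it hold
     from [l = 0] on. *)
  rewrite -(leq_pmul2l (_ : 0 < 2)) // mulnDl mulnDr.
  apply: (@leq_trans (n * (76 * l.+1 ^ 2 + 152 * (l.+1 + 5) ^ 2))); first by lia.
  rewrite mulnCA -[152 * n * _]mulnA mulnCA leq_mul2l; apply/orP; right.
  nia.
apply: labeling_union lab1 lab2 => k le_dk.
by rewrite le_dk ltnNge /= orbC; case: leqP.
Qed.

(** * Binary words and the real bound *)

(** Numbering the labels embeds their type into the words of [m] bits. *)
Lemma preserving_of_labeling n (family : rel 'I_n -> Prop) D m L :
  labeling n (leq D) m -> Rle (INR m) L ->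
  exists dec, preserving_scheme family D dec L.
Proof.
move=> [T [dec [leT labP]]] leL.
have leT' : #|T| <= #|{: m.-tuple bool}| by rewrite card_tuple card_bool.
pose enc t : m.-tuple bool := enum_val (widen_ord leT' (enum_rank t)).
have enc_inj t1 t2 : enc t1 = enc t2 :> seq bool -> t1 = t2.
  move=> /val_inj/enum_val_inj/(congr1 val)/= eq12.
  exact/enum_rank_inj/val_inj.
pose decode s := [pick t | enc t == s :> seq bool].
have encK t : decode (enc t) = Some t.
  rewrite /decode; case: pickP => [t' /eqP/enc_inj->//|/(_ t)].
  by rewrite eqxx.
exists (fun s1 s2 => if (decode s1, decode s2) is (Some t1, Some t2)
                     then Z.of_nat (dec t1 t2) else Z0).
move=> e _; have [lab L_] := labP e; exists (fun u => enc (lab u)).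
split=> [u|u v k dk]; first by rewrite size_tuple.
have [ge eq] := L_ u v k dk; rewrite !encK; split; first by lia.
by move=> /eq ->.
Qed.

(** From [2^l <= d] and [ln 2 > 1/2]. *)
Lemma INR_trunc_log d : 0 < d -> Rle (INR (trunc_log 2 d)) (2 * ln (INR d)).
Proof.
move=> d_gt0; have := @trunc_logP 2 d isT d_gt0; move: (trunc_log 2 d) => l le_d.
have d_pos : Rlt 0 (INR d) by apply/lt_0_INR/ltP.
have INR_exp2 : INR (2 ^ l) = pow 2 l.
  by elim: (l) => [|k IH]; rewrite ?expn0 // expnS mult_INR IH.
have le_pow : Rle (pow 2 l) (INR d) by rewrite -INR_exp2; apply/le_INR/leP.
have pow_pos : Rlt 0 (pow 2 l) by apply: pow_lt; lra.
have le_ln : Rle (INR l * ln 2) (ln (INR d)).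
  rewrite -ln_pow; last lra.
  by case: le_pow => [/(ln_increasing _ _ pow_pos)/Rlt_le//|->]; apply: Rle_refl.
by have := ln_lt_2; have := pos_INR l; nra.
Qed.

Theorem theorem3 :
  exists C : R, Rlt 0 C /\
  forall n D : nat, (1 <= D)%N -> (D <= n)%N ->
    let L := Rmult (Rmult C (Rdiv (INR n) (INR D))) (Rmax (pow (ln (INR D)) 2) 1) in
    (exists dec, preserving_scheme (fun _ : rel 'I_n => True) D dec L) /\
    (exists dec, preserving_scheme (@undirected n) D dec L).
Proof.
(* [7448 = 152 * 49], with 49 from [sq] below. *)
exists (IZR 7448); split; first by lra.
move=> n D D_gt0 _ L.
have [m [le_m lab]] := labeling_from n D_gt0.
(* [labeling] covers every relation, hence both families. *)
suff le_mL : Rle (INR m) L by split; apply: preserving_of_labeling lab le_mL.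
have D_pos : Rlt 0 (INR D) by apply/lt_0_INR/ltP.
have le_l := INR_trunc_log D_gt0.
have l_ge0 := pos_INR (trunc_log 2 D).
have /le_INR : (m * D <= 152 * n * ((trunc_log 2 D + 5) * (trunc_log 2 D + 5)))%coq_nat.
  by apply/leP; rewrite mulnn.
rewrite !mult_INR plus_INR [INR 152]INR_IZR_INZ [INR 5]INR_IZR_INZ /=.
move: (INR (trunc_log 2 D)) (ln (INR D)) @L D_pos le_l l_ge0.
move=> l x L D_pos le_l l_ge0 le_mD.
have n_ge0 := pos_INR n.
(* [l + 5 <= 2x + 5 <= 7 max(x, 1)]. *)
have sq : Rle ((l + 5) * (l + 5)) (49 * Rmax (x ^ 2) 1).
  have [le1 le2] := (Rmax_l (x ^ 2) 1, Rmax_r (x ^ 2) 1).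
  have [x_ge1|x_lt1] := Rle_or_lt 1 x; nra.
apply: (Rmult_le_reg_r (INR D)) => //; apply: Rle_trans le_mD _.
apply: Rle_trans (Rmult_le_compat_l _ _ _ _ sq) _; first nra.
by apply: Req_le; rewrite /L; field; lra.
Qed.
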